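(* Let $k$ be a field and let $A$ be a prime automaton algebra over $k$. Then $A$ is either primitive or $A$ satisfies a polynomial identity.
   Context: Algebras are associative with unit. $k\{x_1,\ldots,x_n\}$ denotes the free associative $k$-algebra on $x_1,\ldots,x_n$. A finite state automaton is a 5-tuple $\Gamma=(Q,\Sigma,\delta,q_0,F)$ where $Q$ is a finite set of states, $\Sigma$ is a finite alphabet, $\delta:Q\times\Sigma\to Q$ is a transition function, $q_0\in Q$ is the initial state, and $F\subseteq Q$ is the set of accepting states. $\Sigma^*$ is the set of finite words on $\Sigma$ (including the empty word $\varepsilon$), and $\delta$ is extended to $Q\times\Sigma^*\to Q$ by $\delta(q,\varepsilon)=q$ and $\delta(q,wx)=\delta(\delta(q,w),x)$ for $w\in\Sigma^*$, $x\in\Sigma$. A word $w\in\Sigma^*$ is accepted by $\Gamma$ if $\delta(q_0,w)\in F$. A monomial algebra $A=k\{x_1,\ldots,x_n\}/I$ (that is, $I$ is a two-sided ideal generated by monomials in $x_1,\ldots,x_n$) is an automaton algebra if there exists a finite state automaton $\Gamma$ with alphabet $\Sigma=\{x_1,\ldots,x_n\}$ such that a word $w\in\Sigma^*$ is accepted by $\Gamma$ if and only if $w\notin I$. A ring is left primitive if it has a faithful simple left module, right primitive if it has a faithful simple right module, and primitive if it is both left and right primitive. A $k$-algebra $A$ satisfies a polynomial identity if there is a nonzero noncommutative polynomial $p(x_1,\ldots,x_m)\in k\{x_1,\ldots,x_m\}$ such that $p(a_1,\ldots,a_m)=0$ for all $(a_1,\ldots,a_m)\in A^m$. *)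

(* Defs.v *)
(* Mathematical Components, with the monoid algebras of multinomials. *)
From mathcomp Require Import all_boot all_algebra.
From mathcomp.multinomials Require Import monalg.

Set Implicit Arguments.
Unset Strict Implicit.
Unset Printing Implicit Defensive.

Import GRing.Theory.
Local Open Scope ring_scope.

(* k{x_1, ..., x_n}: the monoid algebra of the free monoid {fmonom 'I_n}.
   A word w : {fmonom 'I_n} coerces to a seq 'I_n, and << w >> is the
   corresponding monomial (with coefficient 1). *)
Notation free_alg k n := ({malg k[{fmonom 'I_n}]}).

Record automaton (Sigma : finType) := Automaton {
  state : finType;
  delta : state -> Sigma -> state;
  init : state;
  final : {set state}
}.

(* foldl is the extension of delta to words:
   delta(q, eps) = q and delta(q, w x) = delta(delta(q, w), x). *)
Definition accepts (Sigma : finType) (G : automaton Sigma) (w : seq Sigma) :=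
  foldl (@delta _ G) (init G) w \in final G.

(* Closure under opposites follows from closure under multiplication by -1. *)
Definition two_sided_ideal (R : nzRingType) (I : R -> Prop) : Prop :=
  [/\ I 0,
      forall x y, I x -> I y -> I (x + y),
      forall a x, I x -> I (a * x)
    & forall x a, I x -> I (x * a)].

Definition ideal_gen (R : nzRingType) (X : R -> Prop) (x : R) : Prop :=
  forall I : R -> Prop,
    two_sided_ideal I -> (forall y, X y -> I y) -> I x.

Definition monomial_ideal (k : fieldType) (n : nat)
    (I : free_alg k n -> Prop) : Prop :=
  exists S : {fmonom 'I_n} -> Prop,
    forall p, I p <-> ideal_gen (fun q => exists2 w, S w & q = << w >>) p.

(* pi exhibits A as the quotient k{x_1, ..., x_n} / I. *)
Definition is_quotient_by (k : fieldType) (n : nat) (A : algType k)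
    (I : free_alg k n -> Prop) (pi : {lrmorphism free_alg k n -> A}) : Prop :=
  (forall a : A, exists p, pi p = a) /\ (forall p, pi p = 0 <-> I p).

Definition automaton_algebra (k : fieldType) (A : algType k) : Prop :=
  exists (n : nat) (I : free_alg k n -> Prop)
         (pi : {lrmorphism free_alg k n -> A}),
    [/\ monomial_ideal I,
        is_quotient_by I pi
      & exists G : automaton 'I_n,
          forall w : {fmonom 'I_n}, accepts G w <-> ~ I << w >>].

(* An nzRingType is nonzero, so the zero ring is not prime. *)
Definition prime_ring (R : nzRingType) : Prop :=
  forall x y : R, (forall r, x * r * y = 0) -> x = 0 \/ y = 0.

Definition submodule (R : nzRingType) (M : lmodType R) (N : M -> Prop) : Prop :=
  [/\ N 0,
      forall u v, N u -> N v -> N (u + v)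
    & forall a u, N u -> N (a *: u)].

Definition simple_module (R : nzRingType) (M : lmodType R) : Prop :=
  (exists u : M, u <> 0) /\
  forall N : M -> Prop, submodule N ->
    (forall u, N u -> u = 0) \/ (forall u, N u).

Definition faithful_module (R : nzRingType) (M : lmodType R) : Prop :=
  forall a : R, (forall u : M, a *: u = 0) -> a = 0.

Definition left_primitive (R : nzRingType) : Prop :=
  exists M : lmodType R, faithful_module M /\ simple_module M.

(* Right R-modules are left modules over the converse ring R^c. *)
Definition right_primitive (R : nzRingType) : Prop :=
  exists M : lmodType R^c, faithful_module M /\ simple_module M.

Definition primitive_ring (R : nzRingType) : Prop :=
  left_primitive R /\ right_primitive R.

(* p(a_1, ..., a_m); the product follows the order of the letters of w. *)
Definition nc_eval (k : fieldType) (A : algType k) (m : nat)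
    (a : 'I_m -> A) (p : free_alg k m) : A :=
  mmap (in_alg A) (fun w : {fmonom 'I_m} => \prod_(i <- w) a i) p.

Definition satisfies_PI (k : fieldType) (A : algType k) : Prop :=
  exists (m : nat) (p : free_alg k m),
    p <> 0 /\ forall a : 'I_m -> A, nc_eval a p = 0.

(* Main.v *)
(* Let L be the language of nonzero words.  Regularity yields e in L such that
   u e v is in L as soon as u e and e v are.  Call a word of L a first return
   if it meets e exactly at its beginning and at its end.

   If there is at most one first return z e, primeness makes every word of L a
   factor of a power of z.  A product of n words of L is then determined by its
   length and the phase at which it occurs in the periodic word, so the
   multilinear identities of degree n are cut out by at most d K^n linear
   conditions, where K is the number of types of words, and n! unknowns
   outnumber them for n large.

   If x e and y e are distinct first returns, A acts by concatenation on the
   span of the words of L ending in e, modified by x e = 0 and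
   x^(c u) y u = e for every u starting with e, where c is injective and
   c u > |u|.  For a combination of words starting with e, applying x^(c u) y
   with c u maximal on its support leaves a nonzero multiple of e; hence a
   simple quotient.  It is faithful because c u > |u| delays the resets on
   y^N e beyond any prescribed bound.  The condition on L is invariant under
   reversal, which gives right primitivity. *)
From HB Require Import structures.
Require Import Defs.
From mathcomp Require Import all_boot all_algebra.
From mathcomp.multinomials Require Import monalg.
From mathcomp Require Import perm finmap zify.
From mathcomp.classical Require boolp.

Set Implicit Arguments.
Unset Strict Implicit.
Unset Printing Implicit Defensive.

(** * First returns and reduction of words *)

Lemma prefix_catl_size (T : eqType) (e a s : seq T) :
  size e <= size a -> prefix e (a ++ s) -> prefix e a.
Proof. by move=> le_ea; rewrite !prefixE takel_cat. Qed.

(** The two end occurrences of [e] may overlap. Below, [t] is written [x ++ e], and [e] need not be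
    a prefix of [x]. *)
Definition first_return (T : eqType) (L : pred (seq T)) (e t : seq T) :=
  [/\ L t, size e < size t, prefix e t, suffix e t
    & forall i, 0 < i < size t - size e -> ~~ prefix e (drop i t)].

Section FirstReturns.
Variables (T : eqType) (L : pred (seq T)) (e : seq T).

Lemma first_return_inner x i :
  first_return L e (x ++ e) -> 0 < i < size x -> ~~ prefix e (drop i x ++ e).
Proof.
case=> _ _ _ _ inner lt_i; have := inner i.
by rewrite size_cat addnK drop_cat; case/andP: lt_i => -> -> /=; apply.
Qed.

(** If [x] were shorter than [y], the copy of [e] opening [r] would start strictly inside [y ++ e].
    Blocks standing before copies of [e] are thus decoded uniquely from the left. *)
Lemma first_return_parse x y r s :
    first_return L e (x ++ e) -> first_return L e (y ++ e) ->
    prefix e r -> prefix e s ->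
  x ++ r = y ++ s -> x = y.
Proof.
wlog le_xy : x y r s / size x <= size y => [hw|].
  case/orP: (leq_total (size x) (size y)) => le_xy xe ye re se eq_xy.
    exact: (hw x y r s).
  by apply/esym/(hw y x s r).
move=> xe ye re /prefixP[s' ->] eq_xy.
have x0 : 0 < size x by case: xe => _; rewrite size_cat; lia.
have [lt_xy|ge_xy] := ltnP (size x) (size y).
  have := first_return_inner ye (i := size x); rewrite x0 lt_xy => /(_ isT) /negP[].
  apply: (@prefix_catl_size _ e _ s'); first by rewrite size_cat; lia.
  rewrite -catA; move: eq_xy => /(congr1 (drop (size x))).
  by rewrite drop_size_cat // drop_cat lt_xy => <-.
by move/eqP: eq_xy; rewrite eqseq_cat; [case/andP=> /eqP | lia].
Qed.

End FirstReturns.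

Section Reduction.
Variables (T : eqType) (L : pred (seq T)) (e x y : seq T) (c : seq T -> nat).
Hypothesis L_factor : forall u v w, L (u ++ v ++ w) -> L v.
Hypothesis L_sync : forall u v, L (u ++ e) -> L (e ++ v) -> L (u ++ e ++ v).
Hypotheses (Lx : first_return L e (x ++ e)) (Ly : first_return L e (y ++ e)).
Hypotheses (neq_xy : x <> y) (c_inj : injective c).
Hypothesis c_size : forall u, size u < c u.

Let L_right u v : L (u ++ v) -> L v.
Proof. by rewrite -[v in u ++ v]cats0; apply: L_factor. Qed.
Let L_left u v : L (u ++ v) -> L u.
Proof. exact: (@L_factor [::]). Qed.

Definition xpow j : seq T := flatten (nseq j x).

Lemma xpowS j s : xpow j.+1 ++ s = x ++ xpow j ++ s.
Proof. by rewrite /xpow /= -catA. Qed.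

(* Reset words are identified with e.  Together with x e = 0, this makes
   x^(c u) y send u to e and kill every u' such that c u' < c u. *)
Definition reset_word (t : seq T) : bool :=
  has (fun i => prefix e (drop i t) &&
                (t == xpow (c (drop i t)) ++ y ++ drop i t)) (iota 0 (size t).+1).

Lemma reset_wordP t :
  reflect (exists2 u, prefix e u & t = xpow (c u) ++ y ++ u) (reset_word t).
Proof.
apply: (iffP hasP) => [[i _ /andP[eu /eqP def_t]]|[u eu def_t]].
  by exists (drop i t).
have def_u : drop (size t - size u) t = u.
  by rewrite {2}def_t catA drop_size_cat // def_t !size_cat; lia.
exists (size t - size u); first by rewrite mem_iota; lia.
by rewrite def_u eu def_t eqxx.
Qed.

(* None is the zero vector. *)
Definition reduce1 (a : T) (o : option (seq T)) : option (seq T) :=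
  if o is Some t then
    if ~~ L (a :: t) || (a :: t == x ++ e) then None
    else Some (if reset_word (a :: t) then e else a :: t)
  else None.

Definition act (w t : seq T) : option (seq T) := foldr reduce1 (Some t) w.

Lemma act_cat u v t :
  act (u ++ v) t = if act v t is Some t' then act u t' else None.
Proof.
rewrite /act foldr_cat; case: (foldr _ _ v) => //.
by elim: u => //= a u ->.
Qed.

Lemma prefix_x j u : prefix e u -> prefix e (xpow j ++ y ++ u).
Proof.
case/prefixP=> u' ->.
have pre z s : first_return L e (z ++ e) -> prefix e s -> prefix e (z ++ s).
  case=> _ _ /prefixP[z' def_z] _ _ /prefixP[s' ->].
  by rewrite catA def_z -catA prefix_prefix.
elim: j => [|j IHj] /=; first exact/pre/prefix_prefix.
by rewrite /xpow /= -catA; apply: pre.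
Qed.

Lemma reset_word_prefix t : reset_word t -> prefix e t.
Proof. by case/reset_wordP=> u eu ->; apply: prefix_x. Qed.

(** A reset occurs only at a state beginning with [e] and forgets what follows this [e], so the
    state is always [w ++ t], possibly cut off after some occurrence of [e]. [L_sync] glues the
    forgotten part back, which keeps [w ++ t] in [L]. *)
Lemma act_spec w t t' : L t -> act w t = Some t' ->
  L (w ++ t) /\ (t' = w ++ t \/ exists w1 w2 r,
     [/\ w = w1 ++ w2, w2 != [::], t' = w1 ++ e & w2 ++ t = e ++ r]).
Proof.
move=> Lt; elim: w t' => [|a w IHw] t' /=; first by case=> <-; split=> //; left.
case: (act w t) IHw => [s|] //= /(_ s erefl)[Lwt rel_s].
case: ifP => // /negbT; rewrite negb_or negbK => /andP[Las _] [def_t'].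
have Lawt : L (a :: w ++ t).
  case: rel_s => [<- //|[w1 [w2 [r [def_w _ def_s def_w2]]]]]; subst w s.
  rewrite -catA def_w2 -cat_cons; apply: L_sync => //.
  by apply: (@L_right w1); rewrite -def_w2 catA.
split=> //; move: def_t'; case: ifP => [reset|_] <-; last first.
  case: rel_s => [->|[w1 [w2 [r [-> w2n0 -> def_w2]]]]]; first by left.
  by right; exists (a :: w1), w2, r.
have /prefixP[s' def_as] := reset_word_prefix reset.
right; exists [::], (a :: w).
case: rel_s => [def_s|[w1 [w2 [r [def_w _ def_s def_w2]]]]]; subst.
  by exists s'; rewrite -def_as.
have: prefix e (a :: (w1 ++ w2) ++ t).
  have -> : a :: (w1 ++ w2) ++ t = (a :: w1 ++ e) ++ r by rewrite -catA def_w2 /= catA.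
  by rewrite def_as -catA prefix_prefix.
by case/prefixP=> r' def_r'; exists r'; rewrite -def_r'.
Qed.

Lemma act_prefix g t t' : L t -> prefix e g -> act g t = Some t' -> prefix e t'.
Proof.
move=> Lt eg /(act_spec Lt)[_ [->|[w1 [w2 [r [def_g _ -> def_w2]]]]]].
  by case/prefixP: eg => s ->; rewrite -catA prefix_prefix.
apply: (@prefix_catl_size _ e _ r); first by rewrite size_cat; lia.
rewrite -catA -def_w2 catA -def_g.
by case/prefixP: eg => s ->; rewrite -catA prefix_prefix.
Qed.

(** A reset uses up a nonempty part of [g], hence leaves a state shorter than [g ++ t0]. *)
Lemma act_inj_at g t t0 : L t -> size e <= size t0 ->
  act g t = Some (g ++ t0) -> t = t0.
Proof.
move=> Lt le_e /(act_spec Lt)[_ [/eqP|[w1 [w2 [r [-> w2n0 /(congr1 size)]]]]]].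
  by rewrite eqseq_cat // => /andP[_ /eqP].
by rewrite !size_cat; case: (w2) w2n0 => //= b w2'; lia.
Qed.

Lemma act_quiet z u : L (z ++ u) ->
    (forall z1 z2, z = z1 ++ z2 -> z2 != [::] ->
       ~~ reset_word (z2 ++ u) && (z2 ++ u != x ++ e)) ->
  act z u = Some (z ++ u).
Proof.
elim: z => //= a z IHz Lazu quiet.
have /andP[/negPf nreset /negPf nkill] := quiet [::] (a :: z) erefl isT.
rewrite IHz /=; first by rewrite Lazu -cat_cons nkill nreset.
  exact: (@L_right [:: a]).
by move=> z1 z2 def_z; apply: (quiet (a :: z1)); rewrite def_z.
Qed.

Lemma act_quiet_prefix z u : L (z ++ u) ->
    (forall z1 z2, z = z1 ++ z2 -> z2 != [::] -> ~~ prefix e (z2 ++ u)) ->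
  act z u = Some (z ++ u).
Proof.
move=> Lzu quiet; apply: act_quiet => // z1 z2 def_z z20.
have := quiet _ _ def_z z20; case: eqP => [->|_]; last first.
  by rewrite andbT; apply: contra; apply: reset_word_prefix.
by case: Lx => _ _ -> _ _.
Qed.

(** Reset words and [x ++ e] begin with [e], and no copy of [e] starts strictly inside [z]. Only the
    first letter of [z], the last one to act, can reset or kill. *)
Lemma act_return z u : first_return L e (z ++ e) -> prefix e u -> L u ->
  L (z ++ u) /\
  act z u = if z ++ u == x ++ e then None
            else Some (if reset_word (z ++ u) then e else z ++ u).
Proof.
move=> Lz /prefixP[u' ->] Lu.
have Lzu : L (z ++ e ++ u') by apply: L_sync => //; case: Lz.
split=> //; case: z Lz Lzu => [[_]|a z Lz Lzu]; first by rewrite ltnn.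
rewrite (act_cat [:: a]) act_quiet_prefix /= => [|//|z1 z2 def_z z20].
- by rewrite Lzu; case: eqP.
- exact: (@L_right [:: a]).
apply/negP; rewrite catA => /prefix_catl_size; rewrite size_cat => /(_ (leq_addl _ _)).
apply/negP; have := @first_return_inner _ _ _ (a :: z) (size z1).+1 Lz.
by rewrite /= def_z drop_size_cat // size_cat; apply; case: (z2) z20 => //= *; lia.
Qed.

(** By unique decoding [y ++ u] is neither [x ++ e] nor a reset word: the latter starts with a block
    [x], as [c v] is positive. *)
Lemma act_y u : prefix e u -> L u -> L (y ++ u) /\ act y u = Some (y ++ u).
Proof.
move=> eu Lu; have [Lyu ->] := act_return Ly eu Lu; split=> //.
have neq_yx r : prefix e r -> y ++ u <> x ++ r.
  by move=> er /esym/(first_return_parse Lx Ly er eu).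
case: eqP => [/neq_yx[]|_]; first exact: prefix_refl.
case: reset_wordP => // -[v ev]; have := c_size v.
case: (c v) => // j _; rewrite /xpow /= -catA => /neq_yx[]; exact: prefix_x.
Qed.

Lemma act_x u : prefix e u -> L u -> L (x ++ u) /\
  act x u = if u == e then None else
            Some (if reset_word (x ++ u) then e else x ++ u).
Proof.
move=> eu Lu; have [Lxu ->] := act_return Lx eu Lu; split=> //.
by rewrite eqseq_cat // eqxx.
Qed.

Lemma xpow_parse i j u v : prefix e u -> prefix e v ->
  xpow i ++ y ++ u = xpow j ++ y ++ v -> i = j /\ u = v.
Proof.
move=> eu ev; elim: i j => [|i IHi] [|j] /=.
- by move/eqP; rewrite eqseq_cat // => /andP[_ /eqP].
- rewrite /xpow /= -catA => /esym/(first_return_parse Lx Ly).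
  by case/(_ (prefix_x _ ev) eu).
- rewrite /xpow /= -catA => /(first_return_parse Lx Ly).
  by case/(_ (prefix_x _ eu) ev).
rewrite /xpow /= -!catA => /eqP; rewrite eqseq_cat // => /andP[_ /eqP].
by case/IHi=> ->.
Qed.

(** Blocks [x] pile up without effect until there are [c u] of them. The reset then leaves [e], and
    one more [x] gives zero. *)
Lemma act_xpow j u : prefix e u -> L u -> act (xpow j ++ y) u =
  if j < c u then Some (xpow j ++ y ++ u) else
  if j == c u then Some e else None.
Proof.
move=> eu Lu; have [Lyu y_u] := act_y eu Lu; rewrite act_cat y_u.
have c0 := c_size u.
elim: j => [|j IHj]; first by rewrite /= (leq_trans _ c0).
rewrite [act _ _]act_cat -/(xpow j) IHj; case: ltngtP => [lt_jc|gt_jc|eq_jc].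
- have Lj : L (xpow j ++ y ++ u).
    elim: (j) => // i Li; rewrite /xpow /= -catA.
    by case: (act_x (prefix_x _ eu) Li).
  have [_ ->] := act_x (prefix_x _ eu) Lj; case: eqP => [/(congr1 size)|_].
    have [_] := Ly; rewrite !size_cat; case/prefixP: eu => s ->.
    by rewrite size_cat; lia.
  rewrite -xpowS.
  case: reset_wordP => [[v ev /(xpow_parse eu ev)[-> <-]]|nreset].
    by rewrite ltnn eqxx.
  case: (ltngtP j.+1 (c u)) => [//|gt_jc|eq_jc]; first by lia.
  by case: nreset; exists u; rewrite // -eq_jc.
- by case: (ltngtP j.+1) => // lt; lia.
have Le : L e by case/prefixP: eu Lu => s -> /L_left.
have [_ ->] := act_x (prefix_refl e) Le.
by rewrite eqxx; case: (ltngtP j.+1) => // lt; lia.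
Qed.

Lemma act_in w t t' : L t -> act w t = Some t' -> L t'.
Proof.
move=> Lt /(act_spec Lt)[Lwt [-> //|[w1 [w2 [r [def_w _ -> def_w2]]]]]].
by apply: (@L_left _ r); rewrite -catA -def_w2 catA -def_w.
Qed.

Definition ypow j : seq T := flatten (nseq j y).

Lemma ypowS j s : ypow j.+1 ++ s = y ++ ypow j ++ s.
Proof. by rewrite /ypow /= -catA. Qed.

Lemma size_pow j (z : seq T) : size (flatten (nseq j z)) = j * size z.
Proof. by elim: j => //= j IHj; rewrite size_cat IHj mulSn. Qed.

Lemma size_return z : first_return L e (z ++ e) -> 0 < size z.
Proof. by case=> _; rewrite size_cat; lia. Qed.

Lemma act_ypow j u : prefix e u -> L u ->
  [/\ L (ypow j ++ u), prefix e (ypow j ++ u) & act (ypow j) u = Some (ypow j ++ u)].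
Proof.
move=> eu Lu; elim: j => [|j [Lj ej act_j]] //.
rewrite ypowS [act _ _]act_cat -/(ypow j) act_j.
by have [-> ->] := act_y ej Lj; rewrite (@prefix_x 0).
Qed.

(** A copy of [e] starting strictly inside a block [y] would lie inside the first return [y ++ e],
    so copies of [e] start only at block boundaries. *)
Lemma ypow_suffix j h r : prefix e r -> ypow j ++ e = h ++ r ->
  exists i, r = ypow i ++ e.
Proof.
move=> er; elim: j h => [|j IHj] h.
  case/prefixP: er => s -> /(congr1 size); rewrite /= !size_cat => sz.
  have /size0nil -> : size s = 0 by lia.
  by exists 0; rewrite cats0.
have [le_yh|lt_hy] := leqP (size y) (size h).
  rewrite ypowS -{1}(cat_take_drop (size y) h) -catA => /eqP.
  by rewrite eqseq_cat ?size_takel // => /andP[_ /eqP]; apply: IHj.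
move=> def_h; case: h => [|a h] in lt_hy def_h *; first by exists j.+1.
have := first_return_inner Ly (i := (size h).+1); rewrite lt_hy /= => /(_ isT)/negP[].
have def_r : drop (size h).+1 y ++ ypow j ++ e = r.
  have <- : drop (size h).+1 (ypow j.+1 ++ e) = r by rewrite def_h drop_size_cat.
  by rewrite ypowS [RHS]drop_cat /= lt_hy.
have Le : L e by case: Ly => /L_right.
have [_ /prefixP[s def_s] _] := act_ypow j (prefix_refl e) Le.
move: er; rewrite -def_r def_s catA.
by apply: prefix_catl_size; rewrite size_cat leq_addl.
Qed.

(* Since size u < c u, a reset deep inside a power of y would need more letters
   than v supplies. *)
Lemma act_long_ypow v j : size x + size y + size v <= j -> L (v ++ ypow j ++ e) ->
  act v (ypow j ++ e) = Some (v ++ ypow j ++ e).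
Proof.
move=> le_j Lv; have [x0 y0] := (size_return Lx, size_return Ly).
have le_ypow : j <= size (ypow j) by rewrite size_pow leq_pmulr.
apply: act_quiet => // z1 z2 def_v z20; apply/andP; split; last first.
  by apply/eqP => /(congr1 size); rewrite !size_cat; lia.
apply/reset_wordP => -[u eu]; have := c_size u; case: (c u) => // i lt_ui.
have -> : xpow i.+1 = xpow i ++ x.
  by rewrite /xpow -addn1 nseqD flatten_cat /= cats0.
(* If [z2] reaches beyond [xpow i], then [i < size z2], so [u] is shorter than [v] and the left side
   is too long. Otherwise [x ++ y ++ u] is a suffix of the word [ypow j ++ e] and begins with [e];
   this is excluded by its length or by unique decoding. *)
have [le_i|lt_i] := leqP (size z2) (size (xpow i)); last first.
  have le_xpow : i <= size (xpow i) by rewrite size_pow leq_pmulr.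
  by rewrite def_v !size_cat in le_j; move=> /(congr1 size); rewrite !size_cat; lia.
rewrite -(cat_take_drop (size z2) (xpow i)) -!catA => /eqP.
have suf := ypow_suffix (prefix_x 1 eu); rewrite xpowS /= in suf.
rewrite eqseq_cat ?size_takel // => /andP[_ /eqP/suf[[|l]]].
  move=> /(congr1 size); rewrite !size_cat.
  by case/prefixP: eu => s ->; rewrite size_cat /=; lia.
have Le : L e by case: Ly => /L_right.
have [_ e_l _] := act_ypow l (prefix_refl e) Le.
by rewrite ypowS => /(first_return_parse Lx Ly (prefix_x 0 eu) e_l).
Qed.

(** * Linear combinations of states *)

Variable K : fieldType.
Import GRing.Theory.
Local Open Scope ring_scope.

(* A formal K-combination of the values of act, None standing for 0 *)
Definition opt_sum (s : seq (K * option (seq T))) (G : seq T -> K) : K :=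
  \sum_(i <- s) i.1 * oapp G 0 i.2.

Definition weight s t := opt_sum s (fun u => (u == t)%:R).

Lemma opt_sum_group s (G : seq T -> K) :
  opt_sum s G = \sum_(t <- undup (pmap snd s)) weight s t * G t.
Proof.
rewrite /weight /opt_sum.
under [RHS]eq_bigr do rewrite mulr_suml.
rewrite exchange_big /= [LHS]big_seq [RHS]big_seq; apply: eq_bigr => -[a [t|]] /= s_t.
  rewrite (bigD1_seq t) ?undup_uniq //= ?mem_undup ?mem_pmap.
    rewrite eqxx mulr1 big1 ?addr0 // => u; rewrite eq_sym => /negPf ->.
    by rewrite mulr0 mul0r.
  by apply/mapP; exists (a, Some t).
by rewrite mulr0 big1 // => u _; rewrite mul0r.
Qed.

Definition act_sum w (s : seq (K * option (seq T))) :=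
  [seq (i.1, obind (act w) i.2) | i <- s].

Lemma opt_sum_act w s G :
  opt_sum (act_sum w s) G = opt_sum s (fun t => oapp G 0 (act w t)).
Proof. by rewrite /opt_sum big_map; apply: eq_bigr => -[a [t|]]. Qed.

Lemma act_sum_cat u v s : act_sum u (act_sum v s) = act_sum (u ++ v) s.
Proof.
rewrite /act_sum -map_comp; apply: eq_map => -[a [t|]] //=.
by rewrite act_cat; case: (act v t).
Qed.

Lemma seq_argmax (A : eqType) (f : A -> nat) (s : seq A) a : a \in s ->
  exists2 b, b \in s & forall z, z \in s -> (f z <= f b)%N.
Proof.
elim: s a => //= b s IHs a _; case: s IHs => [_|d s /(_ d (mem_head _ _))[m sm max_m]].
  by exists b => [|z]; rewrite ?mem_head // inE => /eqP->.
have [le_bm|lt_mb] := leqP (f b) (f m).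
  by exists m => [|z]; rewrite inE ?sm ?orbT // => /predU1P[->|/max_m].
exists b => [|z]; rewrite ?mem_head // inE => /predU1P[->//|/max_m le_zm].
exact: leq_trans le_zm (ltnW lt_mb).
Qed.

(** A power of [y] first brings every surviving state into the form where it begins with [e],
    without changing the weight of [t0], so some weight stays nonzero. Among the words of nonzero
    weight take [m] with [c m] maximal: [xpow (c m) ++ y] sends [m] to [e] and kills all the others,
    [c] being injective. *)
Lemma isolate s t0 : (forall i t, i \in s -> i.2 = Some t -> L t) ->
    prefix e t0 -> weight s t0 != 0 ->
  exists p g, g != 0 /\ forall G, opt_sum (act_sum p s) G = g * G e.
Proof.
move=> Ls et0 s_t0.
(* Blocks [y] are nonempty, so [size e] of them cover the copy of [e] that begins
   [ypow (size e) ++ e]. *)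
pose g := ypow (size e).
have Le : L e by case: Ly => /L_right.
have eg : prefix e g.
  have [_ eg _] := act_ypow (size e) (prefix_refl e) Le.
  by apply: prefix_catl_size eg; rewrite size_pow leq_pmulr // size_return.
have size_t0 : (size e <= size t0)%N.
  by case/prefixP: et0 => r ->; rewrite size_cat leq_addr.
have Ls_pmap t : t \in pmap snd s -> L t.
  by rewrite mem_pmap => /mapP[i si /esym]; apply: Ls.
have g_t0 : weight (act_sum g s) (g ++ t0) = weight s t0.
  rewrite /weight opt_sum_act /opt_sum big_seq [RHS]big_seq.
  apply: eq_bigr => -[a [t|]] //= /Ls/(_ erefl) Lt; congr (_ * _).
  have [->|ne_t] := eqVneq t t0.
    have Lt0 : L t0.
      apply: contraT => nLt0; case/eqP: s_t0; rewrite /weight /opt_sum big_seq big1 //.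
      move=> -[b [u|]] /= su; last by rewrite mulr0.
      case: eqP => [def_u|]; rewrite ?mulr0 //.
      by case/negP: nLt0; rewrite -def_u (Ls _ _ su).
    by have [_ _ ->] := act_ypow (size e) et0 Lt0; rewrite /= eqxx.
  case def_t': (act g t) => [t'|] //=; case: eqP => // def_t''.
  by case/eqP: ne_t; apply: (@act_inj_at g); rewrite ?def_t' ?def_t''.
pose s1 := act_sum g s; pose W := [seq t <- undup (pmap snd s1) | weight s1 t != 0].
have s1P t : t \in pmap snd s1 -> L t /\ prefix e t.
  rewrite mem_pmap => /mapP[_ /mapP[[a [u|]] su ->]] //= /esym act_u.
  have Lu : L u by exact: (Ls _ _ su).
  by rewrite (act_in Lu act_u) (act_prefix Lu eg act_u).
have : g ++ t0 \in W.
  rewrite mem_filter g_t0 s_t0 mem_undup; apply: contraT => /negP n_t0.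
  case/eqP: s_t0; rewrite -g_t0 /weight /opt_sum big_seq big1 //.
  move=> -[a [u|]] /= su; last by rewrite mulr0.
  case: eqP => [def_u|]; rewrite ?mulr0 //; case: n_t0; rewrite -def_u mem_pmap.
  by apply/mapP; exists (a, Some u).
case/(seq_argmax c) => m; rewrite mem_filter mem_undup.
case/andP=> wm /[dup] s1m /s1P[Lm em] max_m.
exists ((xpow (c m) ++ y) ++ g), (weight s1 m); split=> // G.
rewrite -act_sum_cat opt_sum_act opt_sum_group (bigD1_seq m) ?mem_undup ?undup_uniq //=.
rewrite act_xpow // ltnn eqxx big_seq_cond big1 ?addr0 // => t /andP[].
rewrite mem_undup => s1t ne_t; have [Lt et] := s1P t s1t.
have [->|wt] := eqVneq (weight s1 t) 0; first by rewrite mul0r.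
have: (c t <= c m)%N by apply: max_m; rewrite mem_filter wt mem_undup.
rewrite act_xpow // ltnNge => -> /=.
case: eqP => [/c_inj/esym/eqP|_]; last by rewrite mulr0.
by rewrite (negPf ne_t).
Qed.

End Reduction.

Import GRing.Theory.
Local Open Scope ring_scope.

(** * Left primitivity from a left ideal *)

Section LeftIdealQuotient.
Variables (R : nzRingType) (J : R -> Prop).
Hypotheses (J0 : J 0) (JD : forall a b, J a -> J b -> J (a + b))
  (JM : forall r a, J a -> J (r * a)).

Definition left_ideal_pred : pred R := fun a => boolp.asbool (J a).

Lemma left_ideal_zmod_closed : zmod_closed left_ideal_pred.
Proof.
split=> [|a b /boolp.asboolP Ja /boolp.asboolP Jb]; apply/boolp.asboolP => //.
by rewrite -mulN1r; apply: JD => //; apply: JM.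
Qed.

Definition left_ideal_closed : zmodClosed R :=
  HB.pack left_ideal_pred
    (GRing.isZmodClosed.Build R left_ideal_pred left_ideal_zmod_closed).

Definition left_quot : Type := Quotient.quot left_ideal_closed.
HB.instance Definition _ := GRing.Zmodule.on left_quot.

Let cls (a : R) : left_quot := \pi_(Quotient.quot left_ideal_closed)%qT a.

Lemma clsP a b : cls a = cls b <-> J (a - b).
Proof.
split=> [/eqP|Jab]; last apply/eqP; rewrite /cls -Quotient.idealrBE.
  by move/boolp.asboolP.
exact/boolp.asboolP.
Qed.

Lemma cls_surj u : exists a, u = cls a.
Proof. by exists (generic_quotient.repr u); rewrite /cls generic_quotient.reprK. Qed.

Lemma clsD a b : cls (a + b) = cls a + cls b.
Proof. exact: (Quotient.pi_add left_ideal_closed a b). Qed.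

Definition left_quot_scale (r : R) (u : left_quot) : left_quot :=
  cls (r * generic_quotient.repr u).

Lemma left_quot_scaleE r a : left_quot_scale r (cls a) = cls (r * a).
Proof.
rewrite /left_quot_scale; apply/clsP; rewrite -mulrBr; apply: JM.
by apply/clsP; rewrite /cls generic_quotient.reprK.
Qed.

Fact left_quot_scaleA r s u :
  left_quot_scale r (left_quot_scale s u) = left_quot_scale (r * s) u.
Proof. by have [a ->] := cls_surj u; rewrite !left_quot_scaleE mulrA. Qed.

Fact left_quot_scale1 : left_id 1 left_quot_scale.
Proof. by move=> u; have [a ->] := cls_surj u; rewrite left_quot_scaleE mul1r. Qed.

Fact left_quot_scaleDr : right_distributive left_quot_scale +%R.
Proof.
move=> r u v; have [[a ->] [b ->]] := (cls_surj u, cls_surj v).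
by rewrite -clsD !left_quot_scaleE mulrDr clsD.
Qed.

Fact left_quot_scaleDl u : {morph left_quot_scale^~ u : r s / r + s}.
Proof.
by move=> r s; have [a ->] := cls_surj u; rewrite !left_quot_scaleE mulrDl clsD.
Qed.

HB.instance Definition _ := GRing.Zmodule_isLmodule.Build R left_quot
  left_quot_scaleA left_quot_scale1 left_quot_scaleDr left_quot_scaleDl.

(** The second hypothesis makes every nonzero class generate R / J, which is therefore simple. The
    elements [a] with a R inside J form the annihilator of R / J, so the third hypothesis is
    faithfulness. *)
Lemma left_primitive_of_left_ideal :
    ~ J 1 ->
    (forall a, ~ J a -> exists b, J (b * a - 1)) ->
    (forall a, (forall r, J (a * r)) -> a = 0) ->
  left_primitive R.
Proof.
move=> J1 Jmax Jcore; exists left_quot.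
have cls0 a : cls a = 0 <-> J a.
  have -> : (0 : left_quot) = cls 0.
    by apply: (addrI (cls 0)); rewrite -clsD !addr0.
  by rewrite clsP subr0.
have scaleE r a : r *: cls a = cls (r * a) by exact: left_quot_scaleE.
split=> [a aM|].
  by apply: Jcore => r; apply/cls0; rewrite -scaleE; apply: aM.
split=> [|N [N0 ND NZ]]; first by exists (cls 1) => /cls0.
have [[a [Na nJa]]|noN] := boolp.EM (exists a, N (cls a) /\ ~ J a).
  right=> u; have [c ->] := cls_surj u; have [b Jb] := Jmax a nJa.
  have <- : (c * b) *: cls a = cls c.
    by rewrite scaleE; apply/clsP; rewrite -mulrA -{2}[c]mulr1 -mulrBr; apply: JM.
  exact: NZ.
left=> u; have [a ->] := cls_surj u => Na; apply/cls0.
by apply: boolp.contrapT => nJa; apply: noN; exists a.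
Qed.

End LeftIdealQuotient.

(** * Monomial rings *)

(* A monomial algebra as a ring R with scalars from k, in a form invariant under
   passing to the converse ring and reversing words.  For a predicate P on
   words, mr_coeff P is the functional summing the coefficients of the words
   of mr_lang that satisfy P. *)
Record monomial_ring (k : fieldType) (T : eqType) (R : nzRingType) := MonomialRing {
  mr_lang : pred (seq T);
  mr_scal : k -> R;
  mr_word : seq T -> R;
  mr_coeff : pred (seq T) -> R -> k;
  mr_scalC : forall c r, mr_scal c * r = r * mr_scal c;
  mr_word_nil : mr_word [::] = 1;
  mr_word_cat : forall u v, mr_word (u ++ v) = mr_word u * mr_word v;
  mr_coeff_additive : forall P, zmod_morphism (mr_coeff P);
  mr_coeffZ : forall P c r, mr_coeff P (mr_scal c * r) = c * mr_coeff P r;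
  mr_coeffE : forall P w, mr_coeff P (mr_word w) = (mr_lang w && P w)%:R;
  mr_span : forall r, exists s : seq (k * seq T),
    r = \sum_(i <- s) mr_scal i.1 * mr_word i.2;
  mr_ext : forall r, (forall w, mr_coeff (pred1 w) r = 0) -> r = 0
}.

Section MonomialRing.
Variables (k : fieldType) (T : eqType) (R : nzRingType) (m : monomial_ring k T R).
Local Notation word := (mr_word m).
Local Notation scal := (mr_scal m).
Local Notation coeff := (mr_coeff m).
Local Notation L := (mr_lang m).

HB.instance Definition _ P :=
  GRing.isZmodMorphism.Build R k (coeff P) (mr_coeff_additive m P).

Lemma mr_coeff_sum P (s : seq (k * seq T)) :
  coeff P (\sum_(i <- s) scal i.1 * word i.2) = \sum_(i <- s) i.1 * (L i.2 && P i.2)%:R.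
Proof.
by rewrite raddf_sum; apply: eq_bigr => i _; rewrite /= mr_coeffZ mr_coeffE.
Qed.

Lemma mr_word_sum u v (s : seq (k * seq T)) :
  word u * (\sum_(i <- s) scal i.1 * word i.2) * word v =
  \sum_(i <- [seq (i.1, u ++ i.2 ++ v) | i <- s]) scal i.1 * word i.2.
Proof.
rewrite mulr_sumr mulr_suml big_map; apply: eq_bigr => i _ /=.
by rewrite mulrA -mr_scalC !mr_word_cat !mulrA.
Qed.

End MonomialRing.

(** This reduces right primitivity to left primitivity. It is transparent so that its language
    computes to [mr_lang m \o rev]. *)
Definition converse_monomial_ring (k : fieldType) (T : eqType) (R : nzRingType)
  (m : monomial_ring k T R) : monomial_ring k T R^c.
Proof.
refine (@MonomialRing k T R^c (mr_lang m \o rev) (mr_scal m) (mr_word m \o rev)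
  (fun P => mr_coeff m (P \o rev)) _ _ _ _ _ _ _ _).
- by move=> c r; apply/esym/(mr_scalC m).
- exact: (mr_word_nil m).
- by move=> u v; rewrite /= rev_cat mr_word_cat.
- by move=> P; apply: (mr_coeff_additive m).
- by move=> P c r; rewrite -(mr_coeffZ m) mr_scalC.
- by move=> P w; rewrite mr_coeffE /= revK.
- move=> r; have [s ->] := mr_span m r; exists [seq (i.1, rev i.2) | i <- s].
  by rewrite big_map; apply: eq_bigr => i _ /=; rewrite revK mr_scalC.
- move=> r r0; apply: (mr_ext (m := m)) => w; rewrite -[RHS](r0 (rev w)).
  congr (mr_coeff m _ r); apply: boolp.funext => v /=.
  by rewrite (inj_eq (can_inj (@revK T))).
Defined.

(** * The simple faithful module given by two first returns *)

Section LeftPrimitive.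
Variables (k : fieldType) (T : eqType) (R : nzRingType) (m : monomial_ring k T R).
Local Notation word := (mr_word m).
Local Notation scal := (mr_scal m).
Local Notation coeff := (mr_coeff m).
Local Notation L := (mr_lang m).
Variables (e x y : seq T) (c : seq T -> nat).
Hypothesis L_factor : forall u v w, L (u ++ v ++ w) -> L v.
Hypothesis L_prime : forall u v, L u -> L v -> exists w, L (u ++ w ++ v).
Hypothesis L_sync : forall u v, L (u ++ e) -> L (e ++ v) -> L (u ++ e ++ v).
Hypotheses (Lx : first_return L e (x ++ e)) (Ly : first_return L e (y ++ e)).
Hypotheses (neq_xy : x <> y) (c_inj : injective c).
Hypothesis c_size : forall u, (size u < c u)%N.

Let L_right u v : L (u ++ v) -> L v.
Proof. by rewrite -[v in u ++ v]cats0; apply: L_factor. Qed.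
Let L_left u v : L (u ++ v) -> L u.
Proof. exact: (@L_factor [::]). Qed.
Let Le : L e. Proof. by case: Ly => /L_right. Qed.

Local Notation act := (act L e x y c).
Local Notation act_sum := (act_sum L e x y c).
(* R / J is a quotient of the module spanned by the reduced words, on which mu
   reads off the coefficient of e. *)
Let mu := coeff (fun w => act w e == Some e).
Let J a := forall b, mu (b * a) = 0.
Let states (s : seq (k * seq T)) := [seq (i.1, act i.2 e) | i <- s].

Let act_lang w t : act w e = Some t -> L w.
Proof. by move/(act_spec L_factor L_sync Lx Ly Le) => [/L_left]. Qed.

Let muE w : mu (word w) = (act w e == Some e)%:R.
Proof.
rewrite /mu mr_coeffE; case: eqP => [/act_lang -> //|_]; by rewrite andbF.
Qed.

Let states_lang s i t : i \in states s -> i.2 = Some t -> L t.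
Proof.
by case/mapP=> -[a w] _ -> /= /(act_in L_factor L_sync Lx Ly Le).
Qed.

Let mu_sum p s : mu (word p * \sum_(i <- s) scal i.1 * word i.2) =
  opt_sum (act_sum p (states s)) (fun t => (t == e)%:R).
Proof.
rewrite mulr_sumr /mu raddf_sum /opt_sum !big_map; apply: eq_bigr => i _ /=.
rewrite mulrA -mr_scalC -mulrA -mr_word_cat mr_coeffZ -/mu muE act_cat.
by case: (act i.2 e) => [t|] //=; case: (act p t).
Qed.

Let J_words a : (forall q, mu (word q * a) = 0) -> J a.
Proof.
move=> a0 b; have [s ->] := mr_span m b.
rewrite mulr_suml /mu raddf_sum big1 // => i _ /=.
by rewrite -mulrA mr_coeffZ -/mu a0 mulr0.
Qed.

(** If [mu (word q0 * a)] is nonzero, then [e] has nonzero weight in [word q0 * a] applied to [e].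
    [isolate] turns this combination into [g] times [e]; after division by [g] it acts as 1 does on
    [e]. *)
Let J_max a : ~ J a -> exists b, J (b * a - 1).
Proof.
move=> nJa; have [q0] : exists q, mu (word q * a) <> 0.
  apply: boolp.contrapT => nq; apply/nJa/J_words => q.
  by apply: boolp.contrapT => q0; apply: nq; exists q.
have [s def_a] := mr_span m (word q0 * a); move=> mu_q0.
have [|p [g [g0 iso]]] := isolate L_factor L_sync Lx Ly neq_xy c_inj c_size
  (@states_lang s) (prefix_refl e).
  have -> : weight (states s) e = mu (word q0 * a); last exact/eqP.
  by rewrite def_a -[RHS]/(mu _) -[X in mu X]mul1r -(mr_word_nil m) mu_sum opt_sum_act.
exists (scal g^-1 * word p * word q0); apply: J_words => q.
rewrite mulrBr mulr1 /mu raddfB /= -/mu muE; apply/eqP; rewrite subr_eq0; apply/eqP.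
have -> : word q * (scal g^-1 * word p * word q0 * a) =
    scal g^-1 * (word (q ++ p) * (word q0 * a)).
  by rewrite mr_word_cat !mulrA [scal _ * word q]mr_scalC.
rewrite def_a /mu mr_coeffZ -/mu mu_sum -act_sum_cat opt_sum_act iso mulKf //.
by case: (act q e).
Qed.

(** Suppose that [w0] has a nonzero coefficient in [a]. On a long power of [y] followed by [e], the
    words of [a] act by plain concatenation, so they stay distinct and the coefficient of [w0]
    survives as the weight of [t0]. [isolate] then gives a multiple of [a] on which [mu] is
    nonzero. *)
Let J_core a : (forall r, J (a * r)) -> a = 0.
Proof.
move=> Ja; apply: (mr_ext (m := m)) => w0; apply: boolp.contrapT => a_w0.
have [s def_a] := mr_span m a.
have Lw0 : L w0.
  apply: contraT => nLw0; case: a_w0; rewrite def_a mr_coeff_sum big1 // => i _.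
  by case: (eqVneq i.2 w0) => [->|ne] /=; rewrite ?(negPf nLw0) ?(negPf ne) ?andbF mulr0.
have [w1 Lw1] := L_prime Le Lw0; have [w2 Lw2] := L_prime Lw1 Le.
(* The left context makes the states begin with [e], as [isolate] wants for [t0]; the right one lets
   [w0] be followed by [e], hence by powers of [y]. The exponent [j] meets the bound of
   [act_long_ypow] for all words of [s] at once. *)
pose ctx w := (e ++ w1) ++ w ++ w2; pose D := \max_(i <- s) size (ctx i.2).
pose j := (size x + size y + D)%N; pose z := ypow y j.
have [Lz /prefixP[r ez] act_z] :=
  act_ypow L_factor L_sync Lx Ly neq_xy c_size j (prefix_refl e) Le.
pose s' := [seq (i.1, ctx i.2 ++ z) | i <- s].
have act_s i : i \in s -> act (ctx i.2 ++ z) e =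
    if L (ctx i.2 ++ z ++ e) then Some (ctx i.2 ++ z ++ e) else None.
  move=> si; case: ifP => [Li|nLi].
    rewrite act_cat act_z.
    apply: (act_long_ypow L_factor L_sync Lx Ly neq_xy c_size) => //.
    by rewrite leq_add2l (@leq_bigmax_seq _ s xpredT (fun i => size (ctx i.2))).
  case def_t: (act _ e) => [t|] //.
  by case: (act_spec L_factor L_sync Lx Ly Le def_t); rewrite -catA nLi.
pose t0 := ctx w0 ++ z ++ e.
have Lt0 : L t0.
  have Lctx : L (ctx w0 ++ e) by move: Lw2; rewrite /ctx -!catA.
  by rewrite /t0 ez; apply: L_sync; rewrite -?ez.
have ctx_inj : injective (fun w => ctx w ++ z ++ e).
  move=> u v /[dup] /(congr1 size); rewrite /ctx !size_cat => sz_uv /eqP.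
  have sz : size u = size v by lia.
  by rewrite !eqseq_cat ?size_cat ?sz // => /andP[/andP[_ /andP[/eqP]]].
have et0 : prefix e t0 by rewrite /t0 /ctx -!catA prefix_prefix.
have [|p [g [g0 iso]]] := isolate L_factor L_sync Lx Ly neq_xy c_inj c_size
  (@states_lang s') et0.
  suff -> : weight (states s') t0 = coeff (pred1 w0) a by apply/eqP.
  rewrite def_a mr_coeff_sum /weight /opt_sum !big_map.
  rewrite big_seq [RHS]big_seq; apply: eq_bigr => i si; rewrite act_s //=.
  congr (_ * _); case: ifP => Li /=.
    have -> : L i.2 by move: Li; rewrite /ctx -!catA => /L_right/L_right/L_left.
    by rewrite (inj_eq ctx_inj).
  by case: eqVneq => [def_i|]; rewrite ?andbF //; rewrite def_i Lt0 in Li.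
have := Ja (word (w2 ++ z)) (word p * word (e ++ w1)).
rewrite -mulrA [_ * (a * _)]mulrA def_a mr_word_sum.
have -> : [seq (i.1, (e ++ w1) ++ i.2 ++ w2 ++ z) | i <- s] = s'.
  by apply: eq_map => i; rewrite /ctx -!catA.
rewrite mu_sum iso eqxx mulr1 => g_0.
by rewrite g_0 eqxx in g0.
Qed.

Lemma left_primitive_of_returns : left_primitive R.
Proof.
apply: (@left_primitive_of_left_ideal R J) => //.
- by move=> b; rewrite mulr0 /mu raddf0.
- by move=> a b Ja Jb r; rewrite mulrDr /mu raddfD /= -/mu Ja Jb addr0.
- by move=> r a Ja b; rewrite mulrA.
move=> /(_ 1); rewrite mulr1 -(mr_word_nil m) muE eqxx => /eqP.
by rewrite oner_eq0.
Qed.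

End LeftPrimitive.

Lemma first_return_rev (T : eqType) (L : pred (seq T)) (e t : seq T) :
  first_return L e t -> first_return (L \o rev) (rev e) (rev t).
Proof.
case=> Lt lt_et et te inner; split; rewrite ?size_rev ?prefix_rev //=.
- by rewrite revK.
- by rewrite /suffix !revK.
move=> i lt_i; apply/negP; rewrite drop_rev; set n := (size t - i)%N.
rewrite prefix_rev => /suffixP[h def_t].
have := inner (size h); have /(congr1 size) := def_t.
rewrite size_takel ?size_cat; last by lia.
move=> sz; have -> : (0 < size h < size t - size e)%N by lia.
move=> /(_ isT) /negP[].
by rewrite -(cat_take_drop n t) def_t -catA drop_size_cat // prefix_prefix.
Qed.

Lemma left_primitive_of_first_returns (k : fieldType) (T : countType)
    (R : nzRingType) (m : monomial_ring k T R) (L := mr_lang m) (e t1 t2 : seq T) :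
    (forall u v w, L (u ++ v ++ w) -> L v) ->
    (forall u v, L u -> L v -> exists w, L (u ++ w ++ v)) ->
    (forall u v, L (u ++ e) -> L (e ++ v) -> L (u ++ e ++ v)) ->
    first_return L e t1 -> first_return L e t2 -> t1 <> t2 ->
  left_primitive R.
Proof.
move=> Lf Lp Ls ret1 ret2 neq_t.
have [/suffixP[x def1] /suffixP[y def2]] : suffix e t1 /\ suffix e t2.
  by case: ret1 ret2 => ? ? ? ? ? [].
(* The code of a pair determines it, and it is a positive multiple of 2 to the power [size w], hence
   exceeds [size w]. *)
subst; apply: (@left_primitive_of_returns _ _ _ m e x y
  (fun w => CodeSeq.code [:: size w; choice.pickle w])) => //.
- by move=> eq_xy; rewrite eq_xy in neq_t.
- by move=> u v /(can_inj CodeSeq.codeK)[_ /(pcan_inj choice.pickleK)].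
- move=> u /=; apply: leq_trans (ltn_expl (size u) (isT : 1 < 2)%N) _.
  by rewrite leq_pmulr.
Qed.

(** * Synchronizing words of a regular language *)

(** Let [acc v] be the set of reachable states from which [v] is accepted, and choose [e] accepted
    with [acc e] as small as possible. Closure under factors gives [acc (e ++ v) \subset acc e], so
    equality holds whenever [e ++ v] is accepted. *)
Lemma exists_sync_word (T : finType) (G : automaton T) :
    (forall u v w, accepts G (u ++ v ++ w) -> accepts G v) -> accepts G [::] ->
  exists2 e, accepts G e & forall u v,
    accepts G (u ++ e) -> accepts G (e ++ v) -> accepts G (u ++ e ++ v).
Proof.
move=> Lf L0; pose run := foldl (@delta _ G).
pose acc v := [set q | boolp.asbool (exists u, run (init G) u = q) & run q v \in final G].
have accE u v : (run (init G) u \in acc v) = accepts G (u ++ v).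
  rewrite inE /accepts foldl_cat; case: boolp.asboolP => // -[]; by exists u.
pose P n := boolp.asbool (exists2 v, accepts G v & #|acc v| = n).
have exP : exists n, P n by exists #|acc [::]|; apply/boolp.asboolP; exists [::].
case: (ex_minnP exP) => n /boolp.asboolP[e Le <-] min_e; exists e => // u v Lue Lev.
suff /eqP eq_acc : acc (e ++ v) == acc e by rewrite -accE eq_acc accE.
rewrite eqEcard min_e ?andbT; last by apply/boolp.asboolP; exists (e ++ v).
apply/subsetP => q /[dup]; rewrite {1}inE => /andP[/boolp.asboolP[w <-] _].
by rewrite !accE catA; apply: (Lf [::]).
Qed.

Lemma cat_injr (T : eqType) (s : seq T) : injective (cat^~ s).
Proof.
move=> u v /[dup] /(congr1 size); rewrite !size_cat => /addIn sz_uv /eqP.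
by rewrite eqseq_cat // => /andP[/eqP].
Qed.

(** * Languages with at most one first return *)

Section Thin.
Variables (T : eqType) (L : pred (seq T)) (e : seq T).
Hypothesis L_factor : forall u v w, L (u ++ v ++ w) -> L v.

(** Cut [t] at the first positive position where [e] occurs; it is at most that of the final [e]. *)
Lemma first_return_split t : L t -> prefix e t -> suffix e t -> (size e < size t)%N ->
  exists z t', [/\ t = z ++ t', first_return L e (z ++ e), prefix e t' & suffix e t'].
Proof.
move=> Lt et /suffixP[h def_t] lt_et.
pose P i := (0 < i)%N && prefix e (drop i t).
have exP : exists i, P i.
  exists (size h); rewrite /P def_t drop_size_cat // prefix_refl andbT.
  by move: lt_et; rewrite def_t size_cat; lia.
case: (ex_minnP exP) => i /andP[i0 /[dup] ei /prefixP[r def_i]] min_i.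
have le_ih : (i <= size h)%N.
  apply: min_i; rewrite /P def_t drop_size_cat // prefix_refl andbT.
  by move: lt_et; rewrite def_t size_cat; lia.
have def_t2 : t = take i t ++ e ++ r by rewrite -def_i cat_take_drop.
have sz_i : size (take i t) = i by rewrite size_takel // def_t size_cat; lia.
exists (take i t), (drop i t); split; rewrite ?cat_take_drop //; last first.
  rewrite def_t drop_cat; case: ltngtP le_ih => // [_|->] _.
    exact: suffix_suffix.
  by rewrite subnn drop0 suffix_refl.
split.
- by apply: (@L_factor [::] _ r); rewrite -catA -def_t2.
- by rewrite size_cat sz_i; lia.
- by apply: (@prefix_catl_size _ _ _ r); rewrite ?size_cat ?leq_addl // -catA -def_t2.
- exact: suffix_suffix.
rewrite size_cat addnK sz_i => j /andP[j0 lt_ji]; apply/negP => ej.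
have /negP[] : ~~ (i <= j)%N by rewrite -ltnNge.
apply: min_i; rewrite /P j0 def_t2 catA drop_cat size_cat sz_i ifT; last by lia.
by case/prefixP: ej => s ->; rewrite -catA prefix_prefix.
Qed.

(** Option values allow a sequence that only the empty word matches. *)
Fixpoint matches_at (s : nat -> option T) i w :=
  if w is a :: w' then (s i == Some a) && matches_at s i.+1 w' else true.

Lemma matches_at_cat s i u v :
  matches_at s i (u ++ v) = matches_at s i u && matches_at s (i + size u) v.
Proof.
by elim: u i => [|a u IHu] i; rewrite ?addn0 //= IHu addSnnS andbA.
Qed.

Lemma matches_at_inj s i u v : size u = size v ->
  matches_at s i u -> matches_at s i v -> u = v.
Proof.
elim: u v i => [|a u IHu] [|b v] //= i [sz] /andP[/eqP-> mu] /andP[/eqP[->] mv].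
by rewrite (IHu _ _ sz mu mv).
Qed.

Lemma matches_at_mod s d i w : (forall j, s (j %% d)%N = s j) ->
  matches_at s (i %% d)%N w = matches_at s i w.
Proof.
move=> per; elim: w i => //= a w IHw i; rewrite per; congr (_ && _).
by rewrite -(IHw (i %% d)%N.+1) -(IHw i.+1) -(addn1 (_ %% _)%N) modnDml addn1.
Qed.

Hypothesis L_prime : forall u v, L u -> L v -> exists w, L (u ++ w ++ v).
Hypotheses (Le : L e)
  (ret_uniq : forall t1 t2, first_return L e t1 -> first_return L e t2 -> t1 = t2).

(* With a single first return z ++ e, every word of L lies between two copies
   of e, hence in a power of z. *)
Lemma thin_language : exists d s, [/\ (0 < d)%N, forall j, s (j %% d)%N = s j
  & forall w, L w -> exists i, matches_at s i w].
Proof.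
have surround w : L w -> exists u v, L ((e ++ u) ++ w ++ v ++ e).
  move=> Lw; have [u Lu] := L_prime Le Lw; have [v Lv] := L_prime Lu Le.
  by exists u, v; rewrite -!catA in Lv *.
have [[t ret_t]|no_ret] := boolp.EM (exists t, first_return L e t); last first.
  (* Here [L] has no nonempty word: placed between two copies of [e], it would produce a first
     return. *)
  exists 1%N, (fun=> None); split=> // w /surround[u [v Lw]]; exists 0%N.
  case: w Lw => // a w Lw; case: no_ret.
  have [|||z [t [_ ret _ _]]] := first_return_split Lw; last by exists (z ++ e).
  - by rewrite -catA prefix_prefix.
  - by rewrite !catA suffix_suffix.
  by rewrite !size_cat /=; lia.
have [/suffixP[z def_t] e_t] : suffix e t /\ prefix e t by case: ret_t.
subst t; have z0 : (0 < size z)%N by case: ret_t => _; rewrite size_cat; lia.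
case: z => // a z' in ret_t e_t z0 *; set z := a :: z' in ret_t e_t z0 *.
pose s j := Some (nth a z (j %% size z)%N).
exists (size z), s; split=> // [j|w /surround[u [v Lw]]]; first by rewrite /s modn_mod.
pose pow j := flatten (nseq j z); have powS j : pow j.+1 = z ++ pow j by [].
have match_z : matches_at s 0 z.
  suff main : forall h r, z = h ++ r -> matches_at s (size h) r by exact: (main [::]).
  move=> h r; elim: r h => //= b r IHr h def_z; apply/andP; split.
    by rewrite /s modn_small def_z ?nth_cat ?size_cat /= ?ltnn ?subnn //; lia.
  by rewrite -(size_rcons h b); apply: IHr; rewrite cat_rcons.
have match_pow j : matches_at s 0 (pow j).
  elim: j => // j IHj; rewrite powS matches_at_cat match_z add0n.
  by rewrite -(@matches_at_mod _ (size z)) ?modnn // => i; rewrite /s modn_mod.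
(* Splitting off first returns repeatedly always removes the same block [z], until only [e]
   remains. *)
have pow_e t : L t -> prefix e t -> suffix e t -> exists j, t = pow j ++ e.
  have [n] := ubnP (size t); elim: n t => // n IHn t lt_t Lt et te.
  have [lt_et|ge_et] := ltnP (size e) (size t).
    have [y [t' [def_t ret_y et' te']]] := first_return_split Lt et te lt_et.
    have /cat_injr def_y := ret_uniq ret_y ret_t.
    have [||||j def_t'] := IHn t' => //.
    - by move: lt_t; rewrite def_t def_y size_cat; lia.
    - by apply: (@L_factor y _ [::]); rewrite cats0 -def_t.
    by exists j.+1; rewrite def_t def_y def_t' powS -catA.
  exists 0%N; move/prefixP: et ge_et => [r ->].
  by rewrite size_cat; case: r => [|b r] /=; rewrite ?cats0 //; lia.
(* The final [e] is itself the beginning of a power of [z], so it continues the periodic pattern. *)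
have match_e j : matches_at s 0 (pow j ++ e).
  have e_pow i : prefix e (pow i ++ e).
    elim: i => [|i /prefixP[r def_r]]; first exact: prefix_refl.
    rewrite powS -catA def_r catA.
    by case/prefixP: e_t => q ->; rewrite -catA prefix_prefix.
  have /prefixP[r def_r] : prefix e (pow (size e)).
    apply: prefix_catl_size (e_pow _).
    by elim: (size e) => // i IHi; rewrite powS size_cat; lia.
  have := match_pow (j + size e)%N.
  rewrite /pow nseqD flatten_cat -/(pow j) -/(pow _) def_r.
  by rewrite catA matches_at_cat => /andP[].
have [|||j def_w] := pow_e ((e ++ u) ++ w ++ v ++ e) => //.
- by rewrite -catA prefix_prefix.
- by rewrite !catA suffix_suffix.
exists (size (e ++ u)).
by have := match_e j; rewrite -def_w !matches_at_cat => /andP[_ /andP[]].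
Qed.

End Thin.

(** * Polynomial identities *)

(** For B = 2(K+1), the factorial of B + j is at least B^j = 2^j (K+1)^j. It remains to have d
    (K+1)^B < 2^j, which holds for j = d (K+1)^B. *)
Lemma exp_lt_fact d K : exists m, (d * K ^ m < m`!)%N.
Proof.
have fact_ge B j : (B ^ j <= (B + j)`!)%N.
  elim: j => [|j IHj]; first by rewrite fact_gt0.
  by rewrite addnS factS expnS leq_mul // ltnW // ltnS leq_addr.
pose B := (2 * K.+1)%N; pose j := (d * K.+1 ^ B)%N; exists (B + j)%N.
apply: leq_trans (fact_ge B j).
have le_K : (d * K ^ (B + j) <= d * K.+1 ^ (B + j))%N.
  by rewrite leq_mul2l leq_exp2r ?leqnSn ?orbT //; lia.
apply: leq_ltn_trans le_K _.
by rewrite expnD mulnA expnMn ltn_pmul2r ?expn_gt0 // ltn_expl.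
Qed.

Lemma nonzero_solution (k : fieldType) (I J : finType) (P : I -> J -> bool) :
  (#|J| < #|I|)%N ->
  exists c : I -> k, (exists i, c i != 0) /\ forall j, \sum_(i | P i j) c i = 0.
Proof.
move=> lt_JI.
pose M : 'M[k]_(#|I|, #|J|) := \matrix_(i, j) (P (enum_val i) (enum_val j))%:R.
have: kermx M != 0.
  rewrite -mxrank_eq0 mxrank_ker subn_eq0 -ltnNge.
  exact: leq_ltn_trans (rank_leq_col M) lt_JI.
case/rowV0Pn => v /sub_kermxP vM v0; exists (fun i => v 0 (enum_rank i)); split.
  have [i vi] : exists i, v 0 i != 0.
    apply/existsP; apply: contraT; rewrite negb_exists => /forallP v_0.
    case/eqP: v0; apply/rowP => i; rewrite mxE; apply/eqP.
    by have := v_0 i; rewrite negbK.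
  by exists (enum_val i); rewrite enum_valK.
move=> j; transitivity ((v *m M) 0 (enum_rank j)); last by rewrite vM mxE.
rewrite mxE (reindex_onto (@enum_val I I) enum_rank) /=; last first.
  by move=> i _; rewrite enum_rankK.
rewrite [RHS](eq_bigr (fun i => if P (enum_val i) j then v 0 i else 0)); last first.
  by move=> i _; rewrite mxE enum_rankK; case: ifP; rewrite ?mulr1 ?mulr0.
rewrite -big_mkcond; apply: eq_big => i; first by rewrite enum_valK eqxx andbT.
by rewrite enum_valK.
Qed.

Section ThinPI.
Variables (k : fieldType) (T : eqType) (A : algType k) (m : monomial_ring k T A).
Hypothesis scalE : forall c, mr_scal m c = c%:A.
Local Notation word := (mr_word m).
Local Notation coeff := (mr_coeff m).
Local Notation L := (mr_lang m).
Variables (d : nat) (s : nat -> option T).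
Hypotheses (d0 : (0 < d)%N) (s_mod : forall j, s (j %% d)%N = s j).
Hypothesis L_thin : forall w, L w -> exists i, matches_at s i w.

Definition perm_word n (w : 'I_n -> seq T) (sg : 'S_n) : seq T :=
  flatten [seq w (sg j) | j <- index_enum 'I_n].

(* Whether a product of words matches s at a phase depends only on this data
   for each factor. *)
Definition phase_type := ({ffun 'I_d -> bool} * 'I_d)%type.

Definition phase (i : nat) : 'I_d := Ordinal (ltn_pmod i d0).

Definition type_of (w : seq T) : phase_type :=
  ([ffun i : 'I_d => matches_at s i w], phase (size w)).

Fixpoint chain (i : nat) (ts : seq phase_type) :=
  if ts is t :: ts' then t.1 (phase i) && chain (i + t.2) ts' else true.

Lemma chain_mod i ts : chain (i %% d) ts = chain i ts.
Proof.
elim: ts i => //= t ts IHts i; congr (t.1 _ && _).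
  by apply: val_inj; rewrite /= modn_mod.
by rewrite -IHts modnDml IHts.
Qed.

Lemma matches_at_flatten i ws :
  matches_at s i (flatten ws) = chain i [seq type_of w | w <- ws].
Proof.
elim: ws i => //= w ws IHws i; rewrite matches_at_cat ffunE /= (matches_at_mod _ _ s_mod).
by rewrite IHws -[RHS]/(_ && _) -(chain_mod (i + _ %% d)) modnDmr chain_mod.
Qed.

Lemma size_perm_word n (w : 'I_n -> seq T) sg : size (perm_word w sg) = \sum_j size (w j).
Proof.
rewrite (reindex_perm sg) /= /perm_word size_flatten /shape -map_comp sumnE big_map.
by apply: eq_bigr.
Qed.

(** All the products [perm_word w sg] have the same length. If [v] matches [s] at phase [i], such a
    product of the same length equals [v] exactly when it matches at [i], a condition on the types
    of the factors alone. The equations indexed by a phase and a tuple of types thus handle all [w]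
    together. *)
Lemma perm_word_identity : exists n (c : 'S_n -> k), (exists sg, c sg != 0) /\
  forall w : 'I_n -> seq T, \sum_sg c sg *: word (perm_word w sg) = 0.
Proof.
have [n lt_n] := exp_lt_fact d #|{: phase_type}|.
have [|c [c0 c_sum]] := @nonzero_solution k 'S_n ('I_d * {ffun 'I_n -> phase_type})%type
    (fun sg j => chain j.1 [seq j.2 (sg l) | l <- index_enum 'I_n]).
  by rewrite card_Sn card_prod card_ffun !card_ord.
exists n, c; split=> // w; apply: (mr_ext (m := m)) => v; rewrite raddf_sum /=.
under eq_bigr => sg _.
  rewrite -[c sg *: _]mulr_algl -scalE mr_coeffZ mr_coeffE /=.
over.
have [Lv|nLv] := boolP (L v); last first.
  apply: big1 => sg _; case: eqVneq => [->|_]; rewrite ?(negPf nLv) ?andbF ?mulr0 //.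
have [i match_v] := L_thin Lv.
have [sz_v|sz_v] := eqVneq (size v) (\sum_j size (w j)); last first.
  apply: big1 => sg _; case: eqVneq => [def_v|_]; rewrite ?andbF ?mulr0 //.
  by rewrite -def_v size_perm_word eqxx in sz_v.
rewrite -[RHS](c_sum (phase i, [ffun l => type_of (w l)])) [RHS]big_mkcond.
apply: eq_bigr => sg _ /=; rewrite chain_mod.
have -> : [seq [ffun l => type_of (w l)] (sg l) | l <- index_enum 'I_n] =
    [seq type_of u | u <- [seq w (sg l) | l <- index_enum 'I_n]].
  by rewrite -map_comp; apply: eq_map => l /=; rewrite ffunE.
rewrite -matches_at_flatten -/(perm_word w sg).
case: ifP => match_w.
  have -> : perm_word w sg = v.
    by apply: matches_at_inj match_w match_v; rewrite size_perm_word.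
  by rewrite Lv eqxx mulr1.
case: eqVneq => [def_w|_]; last by rewrite andbF mulr0.
by rewrite def_w match_v in match_w.
Qed.

(** The polynomial is multilinear, so expanding its arguments in words reduces it to
    [perm_word_identity]. *)
Lemma thin_satisfies_PI : satisfies_PI A.
Proof.
have [n [c [[sg0 c_sg0] c_sum]]] := perm_word_identity.
pose mon (sg : 'S_n) : {fmonom 'I_n} := FMonom [seq sg j | j <- index_enum 'I_n].
have mon_inj : injective mon.
  move=> sg tau /(congr1 (@fmonom_val _)) /= /eq_in_map eq_st.
  by apply/permP => j; apply: eq_st; rewrite mem_index_enum.
exists n, (\sum_sg << c sg *g mon sg >>); split.
  move=> /(congr1 (mcoeff (mon sg0))).
  rewrite raddf_sum /= mcoeff0 (bigD1 sg0) //= mcoeffUU.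
  rewrite big1 ?addr0 => [/eqP|sg ne_sg]; first by rewrite (negPf c_sg0).
  by rewrite mcoeffU (inj_eq mon_inj) (negPf ne_sg).
move=> a; rewrite /nc_eval raddf_sum /=.
under eq_bigr => sg _ do rewrite mmapU /= mulr_algl big_map.
(* Padding with zero coefficients gives all [a j] the same number [N] of terms. *)
have [N [C [W def_a]]] : exists N (C : 'I_n -> 'I_N -> k) (W : 'I_n -> 'I_N -> seq T),
    forall j, a j = \sum_l C j l *: word (W j l).
  have [S def_a] := boolp.choice (fun j => mr_span m (a j)).
  exists (\max_j size (S j)), (fun j l => (nth (0, [::]) (S j) l).1),
    (fun j l => (nth (0, [::]) (S j) l).2) => j.
  rewrite def_a (big_nth (0, [::])) big_mkord.
  pose F l := let i := nth (0, [::]) (S j) l in mr_scal m i.1 * word i.2.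
  rewrite (big_ord_widen _ F (leq_bigmax (F := fun j => size (S j)) j)) big_mkcond.
  apply: eq_bigr => l _; rewrite /F /= scalE mulr_algl; case: ltnP => // le_l.
  by rewrite nth_default ?scale0r.
have expand (sg : 'S_n) : \prod_j a (sg j) = \sum_(g : {ffun 'I_n -> 'I_N})
    (\prod_j C j (g j)) *: word (perm_word (fun j => W j (g j)) sg).
  under eq_bigr => j _ do rewrite def_a.
  rewrite (bigA_distr_bigA (fun j l => C (sg j) l *: word (W (sg j) l))) /=.
  (* Composing the choice of terms with [sg] makes the product of coefficients independent of
     [sg]. *)
  rewrite (reindex (fun g : {ffun 'I_n -> 'I_N} => [ffun j => g (sg j)])) /=; last first.
    exists (fun g : {ffun 'I_n -> 'I_N} => [ffun j => g (sg^-1%g j)]) => g _;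
      apply/ffunP => j.
      by rewrite !ffunE permKV.
    by rewrite !ffunE permK.
  apply: eq_bigr => g _; rewrite scaler_prod; congr (_ *: _).
    by rewrite [RHS](reindex_perm sg) /=; apply: eq_bigr => j _; rewrite ffunE.
  rewrite /perm_word; elim: (index_enum _) => [|j js IHjs] /=.
    by rewrite big_nil (mr_word_nil m).
  by rewrite big_cons ffunE IHjs (mr_word_cat m).
under eq_bigr => sg _ do rewrite expand scaler_sumr.
rewrite exchange_big big1 //= => g _.
under eq_bigr => sg _ do rewrite scalerA mulrC -scalerA.
by rewrite -scaler_sumr c_sum scaler0.
Qed.

End ThinPI.

(** * Automaton algebras *)

Section MonomialRingLanguage.
Variables (k : fieldType) (T : eqType) (R : nzRingType) (m : monomial_ring k T R).
Local Notation word := (mr_word m).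
Local Notation L := (mr_lang m).

Lemma mr_lang_neq0 w : L w = (word w != 0).
Proof.
apply/idP/idP => [Lw|]; last first.
  apply: contra_neqT => nLw; apply: (mr_ext (m := m)) => v.
  by rewrite mr_coeffE (negPf nLw).
apply/eqP => w0; have := mr_coeffE m xpredT w; rewrite Lw w0 => /eqP.
by rewrite -(subrr 0) mr_coeff_additive subrr eq_sym oner_eq0.
Qed.

Lemma mr_lang_nil : L [::].
Proof. by rewrite mr_lang_neq0 mr_word_nil oner_eq0. Qed.

Lemma mr_lang_factor u v w : L (u ++ v ++ w) -> L v.
Proof.
rewrite !mr_lang_neq0 !mr_word_cat; apply: contra_neq => ->.
by rewrite mul0r mulr0.
Qed.

Lemma mr_lang_prime : prime_ring R ->
  forall u v, L u -> L v -> exists w, L (u ++ w ++ v).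
Proof.
move=> primeR u v; rewrite !mr_lang_neq0 => /eqP u0 /eqP v0; apply: boolp.contrapT => nw.
have [r| |] := primeR (word u) (word v) => //.
have [s ->] := mr_span m r; rewrite mr_word_sum big_map big1 // => i _ /=.
suff -> : word (u ++ i.2 ++ v) = 0 by rewrite mulr0.
apply/eqP/negbNE; rewrite -mr_lang_neq0; apply/negP => Lw; apply: nw.
by exists i.2.
Qed.

End MonomialRingLanguage.

(** A monomial ideal contains all monomials in the support of its elements. A functional that sums
    coefficients of words outside [I] therefore vanishes on [I] and descends to [A]. *)
Lemma monomial_ring_of_quotient (k : fieldType) (n : nat) (A : algType k)
    (I : free_alg k n -> Prop) (pi : {lrmorphism free_alg k n -> A})
    (L : pred (seq 'I_n)) :
    monomial_ideal I -> is_quotient_by I pi ->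
    (forall w : {fmonom 'I_n}, L w <-> ~ I << w >>) ->
  exists m : monomial_ring k 'I_n A, mr_lang m = L /\ forall c, mr_scal m c = c%:A.
Proof.
move=> [S I_gen] [pi_surj pi_ker] L_I.
have monM (u v : {fmonom 'I_n}) : << mmul u v >> = << u >> * << v >> :> free_alg k n.
  by rewrite malgM_def fgmulUU mulr1.
have notL (w : {fmonom 'I_n}) : pi << w >> = 0 -> L w = false.
  by move=> w0; apply/negP => /L_I; apply; apply/pi_ker.
(* The polynomials all of whose monomials die in [A] form a two-sided ideal containing the
   generators of [I]. *)
have supp p w : pi p = 0 -> w \in msupp p -> pi << w >> = 0.
  move=> /pi_ker/I_gen/(_ (fun p => forall w, w \in msupp p -> pi << w >> = 0)).
  apply=> {p w} [|p [w Sw ->] v]; last first.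
    rewrite msuppU1 in_fset1 => /eqP ->; apply/pi_ker/I_gen => J _; apply.
    by exists w.
  split=> [w|x y x0 y0 w|a x x0 w|x a x0 w]; first by rewrite msupp0.
  - by move/(fsubsetP (msuppD_le x y)); rewrite in_fsetU => /orP[/x0|/y0].
  - by case/msuppM_le => [u [v [_ /x0 xv ->]]]; rewrite monM rmorphM /= xv mulr0.
  - by case/msuppM_le => [u [v [/x0 xu _ ->]]]; rewrite monM rmorphM /= xu mul0r.
have surj a : exists p, pi p == a by have [p <-] := pi_surj a; exists p.
pose lift a := xchoose (surj a).
have liftK a : pi (lift a) = a by exact/eqP/(xchooseP (surj a)).
pose h (P : pred (seq 'I_n)) (w : {fmonom 'I_n}) : k := (L w && P w)%:R.
pose nu P : free_alg k n -> k := mmap idfun (h P).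
have nu0 P p : pi p = 0 -> nu P p = 0.
  move=> p0; rewrite /nu mmapE big_seq big1 // => w /(supp _ _ p0)/notL Lw.
  by rewrite /h Lw mulr0.
have nuB P p q : nu P (p - q) = nu P p - nu P q by rewrite /nu raddfB.
have nuZ P c p : nu P (c *: p) = c * nu P p.
  rewrite /nu (mmapEw (msuppZ_le _ _)) mmapE big_distrr /=.
  by apply: eq_bigr => w _; rewrite mcoeffZ mulrA.
have nu_lift P p : nu P (lift (pi p)) = nu P p.
  by apply/eqP; rewrite -subr_eq0 -nuB nu0 // raddfB /= liftK subrr.
have FM u v : FMonom (u ++ v) = mmul (FMonom u) (FMonom v) :> {fmonom 'I_n}.
  by apply/eqP; rewrite fmP fmM.
unshelve eexists (@MonomialRing k 'I_n A L (fun c => c%:A)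
  (fun w => pi << FMonom w >>) (fun P a => nu P (lift a)) _ _ _ _ _ _ _ _); last by [].
- by move=> c r; rewrite mulr_algl mulr_algr.
- by rewrite -(rmorph1 pi); congr (pi << _ >>); apply/eqP; rewrite fmP fm1.
- by move=> u v; rewrite /= FM monM rmorphM.
- move=> P a b; rewrite -[X in lift (X - _)]liftK -[X in lift (_ - X)]liftK.
  by rewrite -raddfB nu_lift nuB.
- by move=> P c r; rewrite mulr_algl -{1}[r]liftK -linearZ nu_lift nuZ.
- by move=> P w; rewrite /= nu_lift /nu mmapU mul1r.
- move=> r; exists [seq ((lift r)@_w, w : seq 'I_n) | w <- msupp (lift r)].
  rewrite big_map -{1}[r]liftK {1}[lift r]monalgE raddf_sum; apply: eq_bigr => w _ /=.
  rewrite mulr_algl -linearZ /=; congr (pi _); apply/malgP => v.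
  by rewrite mcoeffZ !mcoeffU fmK mulrnAr mulr1.
(* When all coefficients vanish, the support of [lift r] avoids [L], so [pi] kills it term by
   term. *)
move=> r r0; rewrite -[r]liftK [lift r]monalgE raddf_sum big_seq big1 // => w rw /=.
have -> : << (lift r)@_w *g w >> = (lift r)@_w *: << w >> :> free_alg k n.
  by apply/malgP => v; rewrite mcoeffZ !mcoeffU mulrnAr mulr1.
have nLw : L w = false.
  apply/negbTE/negP => Lw; have := r0 w; rewrite /nu mmapE (bigD1_seq w) //=.
  rewrite /h Lw /= eqxx mulr1 big1 ?addr0 => [/eqP|v ne_vw].
    by rewrite mcoeff_eq0 rw.
  by rewrite /= -fmP (negPf ne_vw) andbF mulr0.
rewrite linearZ /=; suff -> : pi << w >> = 0 by rewrite scaler0.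
apply: (pi_ker _).2; apply: boolp.contrapT => nI.
by have := (L_I w).2 nI; rewrite nLw.
Qed.

Theorem theorem4p1 (k : fieldType) (A : algType k)
  (A_prime : prime_ring A) (A_automaton : automaton_algebra A) :
  primitive_ring A \/ satisfies_PI A.
Proof.
have [n [I [pi [I_mon pi_quot [G L_G]]]]] := A_automaton.
have [m [mL m_scal]] := monomial_ring_of_quotient I_mon pi_quot L_G.
have Lf := mr_lang_factor (m := m); have Lp := mr_lang_prime (m := m) A_prime.
have L0 := mr_lang_nil m; rewrite mL in Lf Lp L0.
have [e Le Ls] := exists_sync_word Lf L0.
have [[t1 [t2 [ret1 ret2 neq_t]]]|no_pair] := boolp.EM (exists t1 t2,
  [/\ first_return (accepts G) e t1, first_return (accepts G) e t2 & t1 <> t2]).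
  left; split.
    by apply: (@left_primitive_of_first_returns _ _ _ m e t1 t2); rewrite ?mL.
  (* Closure under factors, primeness, synchronization and first returns all pass to reversed
     words. *)
  apply: (@left_primitive_of_first_returns _ _ _ (converse_monomial_ring m)
    (rev e) (rev t1) (rev t2)); rewrite /= ?mL.
  - by move=> u v w /=; rewrite !rev_cat -catA => /Lf.
  - move=> u v /= Lu Lv; have [w Lw] := Lp _ _ Lv Lu.
    by exists (rev w); rewrite !rev_cat revK -catA.
  - by move=> u v /=; rewrite !rev_cat !revK -catA => Lue Lev; apply: Ls.
  - exact: first_return_rev.
  - exact: first_return_rev.
  by move/(can_inj (@revK _)).
right; have [|d [s [d0 s_mod L_thin]]] := thin_language Lf Lp Le.
  move=> t1 t2 ret1 ret2; apply: boolp.contrapT => neq_t; apply: no_pair.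
  by exists t1, t2.
by apply: (@thin_satisfies_PI _ _ _ m m_scal d s); rewrite ?mL.
Qed.
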